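(* Let $P \subset \mathbb{R}^d$ be a polytope with facets $F_1, \dots, F_n$ and non-empty interior. For any positive weights $\alpha_1, \dots, \alpha_n$, there is a point $c$ in the interior of $P$ such that \[ \sum_{i=1}^n \alpha_i w_i = 0, \] where $w_i$ is the vertex of $(P-c)^\circ$ corresponding to the facet $F_i$ of $P$.
   Context: A polytope is the convex hull of finitely many points in $\mathbb{R}^d$, with $d$ a positive integer; $F_1,\dots,F_n$ is the list of all its (pairwise distinct) facets. The polar of a set $S \subset \mathbb{R}^d$ is $S^\circ = \{x \in \mathbb{R}^d : \langle x, s\rangle \le 1 \text{ for all } s \in S\}$, where $\langle\cdot,\cdot\rangle$ is the standard inner product, and $P - c = \{x - c : x \in P\}$. For any point $c$ of the interior of $P$ there is a one-to-one correspondence between the facets of $P$ and the vertices of $(P-c)^\circ$: the vertex $w$ of $(P-c)^\circ$ corresponds to the facet $F$ of $P$ if $F - c = (P-c) \cap \{y \in \mathbb{R}^d : \langle y, w\rangle = 1\}$. *)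

(* Defs.v *)
From HB Require Import structures.
From mathcomp Require Import all_boot all_order all_algebra.
From mathcomp Require Import all_classical all_reals all_analysis.

Set Implicit Arguments.
Unset Strict Implicit.
Unset Printing Implicit Defensive.

Import Order.TTheory GRing.Theory Num.Theory.
Import numFieldNormedType.Exports.

Local Open Scope classical_set_scope.
Local Open Scope ring_scope.

Definition dotp (R : realType) (d : nat) (x y : 'rV[R]_d) : R :=
  \sum_(j < d) x 0 j * y 0 j.

Definition convex_hull (R : realType) (d : nat) (S : set 'rV[R]_d) :
    set 'rV[R]_d :=
  smallest (@convex_set R 'rV[R]_d) S.

Definition polytope (R : realType) (d : nat) (P : set 'rV[R]_d) : Prop :=
  exists2 S : set 'rV[R]_d, finite_set S & P = convex_hull S.

Definition affinely_independent (R : realType) (d k : nat)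
    (p : 'I_k.+1 -> 'rV[R]_d) : Prop :=
  row_free (\matrix_(i < k) (p (lift ord0 i) - p ord0)).

(* The dimension of A is k when k + 1 is the largest number of affinely
   independent points of A; the empty set has no dimension. *)
Definition has_dim (R : realType) (d : nat) (A : set 'rV[R]_d) (k : nat) :
    Prop :=
  (exists2 p : 'I_k.+1 -> 'rV[R]_d,
     forall i, A (p i) & affinely_independent p) /\
  (forall p : 'I_k.+2 -> 'rV[R]_d,
     (forall i, A (p i)) -> ~ affinely_independent p).

(* The case u = 0 gives the improper faces: P (b = 0) and set0 (b > 0). *)
Definition face (R : realType) (d : nat) (P F : set 'rV[R]_d) : Prop :=
  exists (u : 'rV[R]_d) (b : R),
    (forall x, P x -> dotp x u <= b) /\ F = P `&` [set x | dotp x u = b].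

Definition facet (R : realType) (d : nat) (P F : set 'rV[R]_d) : Prop :=
  face P F /\ exists2 k : nat, has_dim P k.+1 & has_dim F k.

Definition vertex (R : realType) (d : nat) (P : set 'rV[R]_d)
    (w : 'rV[R]_d) : Prop :=
  face P [set w].

Definition polar (R : realType) (d : nat) (S : set 'rV[R]_d) : set 'rV[R]_d :=
  [set x | forall s, S s -> dotp x s <= 1].

Definition translate (R : realType) (d : nat) (P : set 'rV[R]_d)
    (c : 'rV[R]_d) : set 'rV[R]_d :=
  [set x - c | x in P].

Definition corresponding_vertex (R : realType) (d : nat) (P : set 'rV[R]_d)
    (c : 'rV[R]_d) (F : set 'rV[R]_d) (w : 'rV[R]_d) : Prop :=
  vertex (polar (translate P c)) w /\
  translate F c = translate P c `&` [set y | dotp y w = 1].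

(* Main.v *)
Require Import Defs.
From mathcomp Require Import all_boot all_order all_algebra.
From mathcomp Require Import all_classical all_reals all_analysis.
From mathcomp Require Import ring lra.

Import Order.TTheory GRing.Theory Num.Theory.
Import numFieldNormedType.Exports.

Local Open Scope classical_set_scope.
Local Open Scope ring_scope.

(** Fix a point [q] of the interior of [P]. Every facet [F i] lies on a unique
    hyperplane [<x - q, w0 i> = 1] with [<x - q, w0 i> <= 1] on [P], and its
    slack at [x] is [s_i(x) = 1 - <x - q, w0 i>]. Let [c] maximise the weighted
    product [Phi(x) = prod_i s_i(x)^alpha_i] over the compact set [P]. Since
    [Phi(q) = 1], all slacks of [c] are positive, hence positive on a
    neighbourhood of [c]. A polytope is cut out by the inequalities of its
    facets ([facet_separation]), so this neighbourhood is contained in [P], and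
    [c] is an interior point. Recentred at [c], the facet [F i] has the normal
    [w_i = w0_i / s_i(c)], and [- sum_i alpha_i w_i] is the gradient of [log
    Phi] at [c]; it vanishes because [c] is an interior maximum. In place of a
    derivative, the proof compares [Phi(c)] with [Phi(c - t g)] for small [t >
    0] and [g = sum_i alpha_i w_i], which gives [- <g, g> >= 0]
    ([weighted_prod_first_order]).

    The geometric core is that a point [x] outside [P] violates the inequality
    of some facet, where a facet is defined by affine dimension. Projecting [x]
    on [P] gives a normal [u] with [<y - q, u> <= 1] on [P] and [<x - q, u> >
    1]. The normals valid on [P] form a bounded polyhedron, given by one
    inequality for each of the finitely many points whose hull is [P], and [u]
    can be moved to a vertex of it without decreasing [<x - q, u>], as in the
    simplex method ([pivot]). At a vertex the tight points span the whole space
    linearly, so the corresponding face of [P] contains [d] affinely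
    independent points: it is a facet ([facet_of_basis]).

    Conversely, [d] affinely independent points [p_j] of a facet span the space
    as seen from an interior point [c] ([facet_basis]). They determine the
    normal [w], and the functional [<., sum_j (p_j - c)>] attains its maximum
    over the polar only at [w], so [w] is a vertex ([facet_vertex]). *)

Set Implicit Arguments.
Unset Strict Implicit.
Unset Printing Implicit Defensive.

(** * The dot product *)

Section DotProduct.
Context {R : realType} {d : nat}.
Implicit Types (x y u v : 'rV[R]_d).

Lemma dotpE x y : dotp x y = (x *m y^T) 0 0.
Proof. by rewrite mxE; apply: eq_bigr => j _; rewrite mxE. Qed.

Lemma dotpC x y : dotp x y = dotp y x.
Proof. by apply: eq_bigr => j _; rewrite mulrC. Qed.

Lemma dotpDl x y u : dotp (x + y) u = dotp x u + dotp y u.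
Proof. by rewrite !dotpE mulmxDl mxE. Qed.

Lemma dotpBl x y u : dotp (x - y) u = dotp x u - dotp y u.
Proof. by rewrite !dotpE mulmxBl !mxE. Qed.

Lemma dotpZl (a : R) x u : dotp (a *: x) u = a * dotp x u.
Proof. by rewrite !dotpE -scalemxAl mxE. Qed.

Lemma dotpNl x u : dotp (- x) u = - dotp x u.
Proof. by rewrite -scaleN1r dotpZl mulN1r. Qed.

Lemma dotp0l u : dotp 0 u = 0.
Proof. by rewrite dotpE mul0mx mxE. Qed.

Lemma dotpDr x y u : dotp u (x + y) = dotp u x + dotp u y.
Proof. by rewrite !(dotpC u) dotpDl. Qed.

Lemma dotpBr x y u : dotp u (x - y) = dotp u x - dotp u y.
Proof. by rewrite !(dotpC u) dotpBl. Qed.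

Lemma dotpZr (a : R) x u : dotp u (a *: x) = a * dotp u x.
Proof. by rewrite !(dotpC u) dotpZl. Qed.

Lemma dotp0r u : dotp u 0 = 0.
Proof. by rewrite dotpC dotp0l. Qed.

Lemma dotp_suml (I : Type) (r : seq I) (p : I -> 'rV[R]_d) u :
  dotp (\sum_(i <- r) p i) u = \sum_(i <- r) dotp (p i) u.
Proof.
apply: (big_ind2 (fun x a => dotp x u = a)) => [|x a y b <- <-|//].
- exact: dotp0l.
- exact: dotpDl.
Qed.

Lemma dotp_sumr (I : Type) (r : seq I) (p : I -> 'rV[R]_d) u :
  dotp u (\sum_(i <- r) p i) = \sum_(i <- r) dotp u (p i).
Proof. by rewrite dotpC dotp_suml; apply: eq_bigr => i _; rewrite dotpC. Qed.

Lemma dotp_ge0 u : 0 <= dotp u u.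
Proof. by apply: sumr_ge0 => j _; rewrite -expr2 sqr_ge0. Qed.

Lemma dotp_eq0 u : (dotp u u == 0) = (u == 0).
Proof.
apply/eqP/eqP => [u0|->]; last exact: dotp0l.
apply/rowP => j; rewrite mxE; apply/eqP; rewrite -sqrf_eq0 expr2; apply/eqP.
by apply: (psumr_eq0P _ u0) => // i _; rewrite -expr2 sqr_ge0.
Qed.

Lemma dotp_gt0 u : (0 < dotp u u) = (u != 0).
Proof. by rewrite lt_def dotp_ge0 andbT dotp_eq0. Qed.

Lemma dotp_row m (A : 'M[R]_(m, d)) i v : dotp (row i A) v = (A *m v^T) i 0.
Proof. by rewrite dotpE -row_mul mxE. Qed.

Lemma dotp_continuousl u : continuous (fun x => dotp x u).
Proof.
apply: continuous_big => [|j _ x]; first exact: add_continuous.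
exact: (cvgM (@coord_continuous R 1 d 0 j x) (cvg_cst (u 0 j))).
Qed.

End DotProduct.

(** * Moving a valid normal to a vertex *)

Section RowFull.
Context {R : realType} {d m : nat}.
Implicit Types (A : 'M[R]_(m, d)) (v : 'rV[R]_d).

Lemma row_full_tr A : row_full A = row_free A^T.
Proof. by rewrite /row_full /row_free mxrank_tr. Qed.

Lemma row_full_orth A v : row_full A -> (forall i, dotp (row i A) v = 0) ->
  v = 0.
Proof.
rewrite row_full_tr => Afree Av0; apply: (row_free_inj Afree).
rewrite mul0mx; apply/rowP => i.
by rewrite [RHS]mxE -(Av0 i) dotp_row -[v in LHS]trmxK -trmx_mul mxE.
Qed.

Lemma not_row_full_orth A : ~~ row_full A ->
  exists2 v, v != 0 & forall i, dotp (row i A) v = 0.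
Proof.
rewrite row_full_tr -kermx_eq0 => /rowV0Pn[v /sub_kermxP vA v0].
exists v => // i; rewrite dotp_row -[A]trmxK -trmx_mul vA trmx0.
by rewrite mxE.
Qed.

End RowFull.

Section Pivot.
Context {R : realType} {d m : nat} (p : 'I_m -> 'rV[R]_d).
Implicit Types (u v x : 'rV[R]_d).

(** Zeroing the slack rows keeps the size fixed while [u] varies, and does not
    change the span of the tight rows. *)
Definition tight_mx u : 'M[R]_(m, d) :=
  \matrix_(i < m) (if dotp (p i) u == 1 then p i else 0).

Lemma row_tight u i :
  row i (tight_mx u) = if dotp (p i) u == 1 then p i else 0.
Proof. by rewrite rowK. Qed.

(** Without this, moving along [v] might never make a new point tight. *)
Hypothesis p_pos : forall v, v != 0 -> exists i, 0 < dotp (p i) v.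

(** A direction [v] orthogonal to the tight points keeps them tight. By
    [p_pos], moving along [v] or [- v], whichever does not decrease [dotp x],
    is blocked by some point; the first one to block becomes tight, and it is
    not in the span of the old tight points because [v] is not orthogonal to
    it. *)
Lemma pivot_step x u : (forall i, dotp (p i) u <= 1) ->
    ~~ row_full (tight_mx u) ->
  exists u', [/\ forall i, dotp (p i) u' <= 1, dotp x u <= dotp x u' &
    (\rank (tight_mx u) < \rank (tight_mx u'))%N].
Proof.
move=> u_feas /not_row_full_orth[v0 v0_neq0 v0_tight].
have [v [v_neq0 v_tight xv]] : exists v,
    [/\ v != 0, forall i, dotp (row i (tight_mx u)) v = 0 & 0 <= dotp x v].
  have [xv|/ltW xv] := leP 0 (dotp x v0); first by exists v0.
  exists (- v0); rewrite oppr_eq0 -scaleN1r; split=> // [i|].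
    by rewrite dotpZr v0_tight mulr0.
  by rewrite dotpZr mulN1r oppr_ge0.
have [i1 i1v] := p_pos v_neq0.
pose ratio i := (1 - dotp (p i) u) / dotp (p i) v.
have [i0 i0v i0min] :=
  arg_minP (P := fun i => 0 < dotp (p i) v) ratio i1v.
set t := ratio i0 in i0min.
have t_ge0 : 0 <= t by rewrite divr_ge0 ?subr_ge0 // ltW.
have i0t : dotp (p i0) (u + t *: v) = 1.
  by rewrite dotpDr dotpZr divfK ?gt_eqF// subrKC.
have keep i : dotp (p i) u = 1 -> dotp (p i) v = 0.
  by move=> iu; rewrite -(v_tight i) row_tight iu eqxx.
exists (u + t *: v); split.
- move=> i; rewrite dotpDr dotpZr; have [iv|iv] := leP (dotp (p i) v) 0.
    by rewrite -[leRHS]addr0 lerD ?u_feas// mulr_ge0_le0.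
  by rewrite -lerBrDl -ler_pdivlMr// i0min.
- by rewrite dotpDr dotpZr lerDl mulr_ge0.
- apply: rank_ltmx; rewrite ltmxE; apply/andP; split.
    apply/row_subP => i; rewrite row_tight; case: ifPn => [/eqP iu|_].
      have -> : p i = row i (tight_mx (u + t *: v)).
        by rewrite row_tight dotpDr dotpZr iu (keep i iu) mulr0 addr0 eqxx.
      exact: row_sub.
    exact: sub0mx.
  apply/negP => /(submx_trans (row_sub i0 _)).
  rewrite row_tight i0t eqxx => /submxP[l i0E].
  move: i0v; rewrite dotpE i0E -mulmxA (_ : tight_mx u *m v^T = 0).
    by rewrite mulmx0 mxE ltxx.
  by apply/colP => i; rewrite -dotp_row v_tight mxE.
Qed.

Lemma pivot x u : (forall i, dotp (p i) u <= 1) ->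
  exists u', [/\ forall i, dotp (p i) u' <= 1, dotp x u <= dotp x u' &
    row_full (tight_mx u')].
Proof.
have [k] := ubnP (d - \rank (tight_mx u)).
elim: k u => // k IH u; rewrite ltnS => leuk u_feas.
have [|u_nfull] := boolP (row_full (tight_mx u)); first by exists u.
have [u1 [u1_feas xu1 rk1]] := pivot_step x u_feas u_nfull.
have [|u2 [u2_feas xu2 u2_full]] := IH u1 _ u1_feas.
  apply: leq_trans leuk; apply: ltn_sub2l => //.
  by apply: leq_trans rk1 (rank_leq_col _).
by exists u2; split=> //; exact: le_trans xu2.
Qed.

End Pivot.

(** * Dimension and facets as seen from an interior point *)

Section Dimension.
Context {R : realType} {d : nat}.
Implicit Types (P F : set 'rV[R]_d) (q u v w x y : 'rV[R]_d).

Lemma interior_box P q : P° q ->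
  exists2 e : R, 0 < e & forall y, (forall j, `|y 0 j| < e) -> P (q + y).
Proof.
move=> /nbhs_ballP[e /= e_gt0 qP]; exists e => // y ye; apply: qP.
split=> // i j; rewrite ord1 /ball/= mxE opprD addrA subrr add0r normrN.
exact: ye.
Qed.

Lemma interior_dir P q v : P° q ->
  exists2 e : R, 0 < e & forall t, 0 <= t -> t <= e -> P (q + t *: v).
Proof.
move=> /interior_box[e e_gt0 qP]; pose s := \sum_j `|v 0 j|.
have s1_gt0 : 0 < s + 1 by rewrite ltr_wpDl// sumr_ge0.
exists (e / (s + 1)) => [|t t_ge0]; first exact: divr_gt0.
rewrite ler_pdivlMr// => ts; apply: qP => j; rewrite mxE normrM ger0_norm//.
have : `|v 0 j| <= s by rewrite /s (bigD1 j)//= lerDl sumr_ge0.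
by have := normr_ge0 (v 0 j); nra.
Qed.

Lemma interior_supp_lt P q u (b : R) : P° q -> u != 0 ->
  (forall x, P x -> dotp x u <= b) -> dotp q u < b.
Proof.
move=> qP u_neq0 Pub; have [e e_gt0 Pe] := interior_dir u qP.
have /Pub := Pe e (ltW e_gt0) (lexx e); apply: lt_le_trans.
by rewrite dotpDl dotpZl ltrDl mulr_gt0// dotp_gt0.
Qed.

Lemma interior_affinely_independent P q k : P° q -> (k <= d)%N ->
  exists2 p : 'I_k.+1 -> 'rV[R]_d, forall i, P (p i) & affinely_independent p.
Proof.
move=> /interior_box[e e_gt0 qP] kd.
pose a (i : 'I_k.+1) : 'rV[R]_d := \row_j ((j.+1 == i)%:R * (e / 2)).
exists (fun i => q + a i) => [i|].
  apply: qP => j; rewrite mxE normrM [`|e / 2|]gtr0_norm ?divr_gt0//.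
  by case: eqP => _; rewrite ?normr1 ?normr0 ?mul1r ?mul0r //; lra.
rewrite /affinely_independent (_ : (\matrix_i _) = (e / 2) *: pid_mx k).
  rewrite /row_free mxrank_scale_nz ?rank_pid_mx// gt_eqF// divr_gt0//.
apply/matrixP => i j; rewrite !mxE /= /bump leq0n add1n eqSS eq_sym ltn_ord.
by rewrite andbT mul0r addr0 addrAC subrr add0r mulrC.
Qed.

Lemma has_dim_interior P q : P° q -> has_dim P d.
Proof.
move=> qP; split; first exact: interior_affinely_independent qP (leqnn d).
move=> p _; rewrite /affinely_independent /row_free => /eqP rk.
by have := rank_leq_col (\matrix_(i < d.+1) (p (lift ord0 i) - p ord0));
  rewrite rk ltnn.
Qed.

Lemma has_dim_interior_uniq P q k : P° q -> has_dim P k -> k = d.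
Proof.
move=> qP [[p _ pP] kmax]; have kd : (k <= d)%N.
  by rewrite -(eqP pP) rank_leq_col.
apply/eqP; rewrite eqn_leq kd leqNgt; apply/negP => ltkd.
have [p' p'P p'ind] := interior_affinely_independent qP ltkd.
exact: kmax p'P p'ind.
Qed.

(** A facet of a full-dimensional set lies on a hyperplane that misses the
    interior point [q], and [d] affinely independent points of that hyperplane
    are linearly independent as seen from [q]. *)
Lemma facet_basis P F q : P° q -> facet P F ->
  exists w, exists k, exists p : 'I_k -> 'rV[R]_d,
  [/\ forall x, P x -> dotp (x - q) w <= 1,
      F = P `&` [set x | dotp (x - q) w = 1],
      forall i, F (p i) & row_full (\matrix_i (p i - q))].
Proof.
move=> qP [[u [b [Pub FE]]] [k Pk [[p Fp p_ind] kmax]]].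
have dE := has_dim_interior_uniq qP Pk.
have u_neq0 : u != 0.
  apply/eqP => u0; have [p' p'P p'ind] := Pk.1.
  apply: (kmax p') => // i; rewrite FE; split=> //=.
  by have := Fp ord0; rewrite FE u0 => -[_ /=]; rewrite !dotp0r.
have qub := interior_supp_lt qP u_neq0 Pub.
have bq_gt0 : 0 < b - dotp q u by rewrite subr_gt0.
pose w := (b - dotp q u)^-1 *: u.
have wE x : dotp (x - q) w = (dotp x u - dotp q u) / (b - dotp q u).
  by rewrite dotpZr dotpBl mulrC.
have FE1 : F = P `&` [set x | dotp (x - q) w = 1].
  rewrite FE; congr (_ `&` _); apply/seteqP; split=> x /=.
    by rewrite wE => ->; rewrite divff// gt_eqF.
  by rewrite wE => /divr1_eq/addIr.
have {}p_ind : row_full (\matrix_i (p i - q)).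
  suff : row_free (\matrix_i (p i - q)).
    by move/eqP => rk; rewrite /row_full rk dE.
  rewrite -kermx_eq0; apply/rowV0P => l /sub_kermxP.
  rewrite mulmx_sum_row => l0.
  (* A relation between the [p i - q] has total weight 0, since [dotp _ w] is 1
     on each of them; so it is a relation between the [p i - p ord0]. *)
  have lsum : \sum_i l 0 i = 0.
    rewrite -[RHS](dotp0l w) -l0 dotp_suml; apply: eq_bigr => i _.
    rewrite dotpZl rowK.
    by have := Fp i; rewrite FE1 => -[_ /= ->]; rewrite mulr1.
  have l'0 : \row_i l 0 (lift ord0 i) = 0.
    apply: (row_free_inj p_ind); rewrite mul0mx mulmx_sum_row.
    under eq_bigr do rewrite rowK mxE.
    have : \sum_i l 0 i *: (p i - p ord0) = 0.
      under eq_bigr do rewrite -(subrKA q) scalerDr.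
      rewrite big_split/= -scaler_suml lsum scale0r addr0 -[RHS]l0.
      by apply: eq_bigr => i _; rewrite rowK.
    by rewrite big_ord_recl subrr scaler0 add0r.
  have ll i : l 0 (lift ord0 i) = 0.
    by move/rowP: l'0 => /(_ i); rewrite !mxE.
  apply/rowP => i; rewrite mxE; case: (unliftP ord0 i) => [j ->|->] //.
  by move: lsum; rewrite big_ord_recl big1 ?addr0.
exists w, k.+1, p; split=> // x Px.
by rewrite wE ler_pdivrMr// mul1r lerD2r Pub.
Qed.
End Dimension.

(** * Convex hulls of finitely many points *)

Section Convexity.
Context {R : realType} {d : nat}.
Implicit Types (P S A : set 'rV[R]_d) (q u v w x y : 'rV[R]_d).

Lemma convex_setD A x y (t : R) : @convex_set R 'rV[R]_d A ->
  A x -> A y -> 0 <= t -> t <= 1 -> A (t *: x + (1 - t) *: y).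
Proof.
move=> cA Ax Ay t0 t1.
by have := cA x y (Itv01 t0 t1); rewrite !inE; apply.
Qed.

Lemma convex_hull_convex S : @convex_set R 'rV[R]_d (convex_hull S).
Proof.
move=> x y t; rewrite !inE => Sx Sy A [cA SA].
by apply: set_mem; apply: (cA); apply: mem_set; [exact: Sx|exact: Sy].
Qed.

Lemma convex_hull_le S u (b : R) : (forall s, S s -> dotp s u <= b) ->
  forall x, convex_hull S x -> dotp x u <= b.
Proof.
move=> Sb; apply: (smallest_sub (X := [set x | dotp x u <= b])) => //.
move=> x y t; rewrite !inE /= => xb yb.
rewrite dotpDl !dotpZl -[leRHS](subrKC (t%:num * b)) -[X in X - _]mul1r -mulrBl.
by rewrite lerD// ler_wpM2l// subr_ge0.
Qed.

(** The weights are not normalised, so that the induction hypothesis applies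
    directly to the points that remain after the first one. *)
Lemma convex_comb A m (p : 'I_m -> 'rV[R]_d) (l : 'I_m -> R) :
  @convex_set R 'rV[R]_d A -> (forall i, A (p i)) -> (forall i, 0 <= l i) ->
  forall s, 0 < s -> s = \sum_i l i ->
  A (s^-1 *: \sum_i l i *: p i).
Proof.
move=> cA; elim: m p l => [|m IH] p l pA l_ge0 s s_gt0 sE.
  by move: s_gt0; rewrite sE big_ord0 ltxx.
rewrite big_ord_recl; set y := \sum_(i < m) _.
pose s' := \sum_(i < m) l (lift ord0 i).
have {}s'_ge0 : 0 <= s' by apply: sumr_ge0.
have {}sE : s = l ord0 + s' by rewrite sE big_ord_recl.
have [s'0|s'_neq0] := eqVneq s' 0.
  have -> : y = 0.
    apply: big1 => i _; have /psumr_eq0P := s'0.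
    by move=> -> //; rewrite scale0r.
  move: sE; rewrite s'0 !addr0 => <-.
  by rewrite scalerA mulVf ?scale1r// gt_eqF.
have s'_gt0 : 0 < s' by rewrite lt_def s'_neq0.
have Ay : A (s'^-1 *: y) by apply: IH.
have -> : s^-1 *: (l ord0 *: p ord0 + y) =
    (l ord0 / s) *: p ord0 + (1 - l ord0 / s) *: (s'^-1 *: y).
  rewrite scalerDr !scalerA [s^-1 * _]mulrC; congr (_ + _ *: _).
  by rewrite sE in s_gt0 *; field; rewrite s'_neq0 gt_eqF.
apply: convex_setD => //; first by rewrite divr_ge0// ltW.
by rewrite ler_pdivrMr// mul1r sE lerDl.
Qed.

(** The description from which compactness follows: a continuous image of the
    standard simplex. *)
Lemma convex_hull_range m (p : 'I_m -> 'rV[R]_d) :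
  convex_hull (range p) =
  (fun l : 'rV[R]_m => \sum_i l 0 i *: p i) @`
    ([set l : 'rV[R]_m | forall i, `[0, 1]%classic (l 0 i)] `&`
     [set l : 'rV[R]_m | dotp l (const_mx 1) = 1]).
Proof.
have dotp1 (l : 'rV[R]_m) : dotp l (const_mx 1) = \sum_i l 0 i.
  by apply: eq_bigr => i _; rewrite mxE mulr1.
apply/seteqP; split.
  apply: smallest_sub.
    move=> x y t; rewrite !inE /= => -[l [l01 l1] <-] [k [k01 k1] <-].
    exists (t%:num *: l + (1 - t%:num) *: k).
      split=> /= [i|]; last by rewrite dotpDl !dotpZl l1 k1 !mulr1 subrKC.
      have := l01 i; have := k01 i; rewrite /= !in_itv/= !mxE.
      move=> /andP[k0 k1'] /andP[l0 l1'].
      have t0 : 0 <= t%:num by []. have t1 : t%:num <= 1 by [].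
      apply/andP; split; nra.
    rewrite /conv/= !scaler_sumr -big_split; apply: eq_bigr => i _ /=.
    by rewrite !mxE scalerDl !scalerA.
  move=> _ [i _ <-]; exists (delta_mx 0 i).
    split=> /= [j|].
      by rewrite mxE eqxx in_itv/=; case: (j == i); rewrite ?lexx ?ler01.
    rewrite dotp1 (bigD1 i)//= big1 ?mxE ?eqxx ?addr0// => j /negPf ji.
    by rewrite mxE ji andbF.
  rewrite (bigD1 i)//= big1 ?mxE ?eqxx ?scale1r ?addr0// => j /negPf ji.
  by rewrite mxE ji andbF scale0r.
move=> _ [l [l01 /= l1] <-].
rewrite -[X in _ X](scale1r (\sum_i _)) -[X in X *: _]invr1.
apply: convex_comb => //; first exact: convex_hull_convex.
- by move=> i; apply: sub_gen_smallest; exists i.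
- by move=> i; have := l01 i; rewrite /= in_itv/= => /andP[].
- by rewrite -l1 dotp1.
Qed.

Lemma convex_hull_compact m (p : 'I_m -> 'rV[R]_d) :
  compact (convex_hull (range p)).
Proof.
rewrite convex_hull_range; apply: continuous_compact.
  apply: continuous_subspaceT; apply: (@continuous_big 'rV[R]_d).
    exact: add_continuous.
  move=> i _ l; exact: (cvgZ (@coord_continuous R 1 m 0 i l) (cvg_cst (p i))).
apply: compact_closedI; first by
  apply: (@rV_compact R m (fun=> `[0, 1]%classic)) => _; exact: segment_compact.
have /continuous_closedP cdot := @dotp_continuousl R m (const_mx 1).
exact: cdot (@closed_eq R 1).
Qed.

Lemma polytopeE P : polytope P ->
  exists m, exists p : 'I_m -> 'rV[R]_d, P = convex_hull (range p).
Proof.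
move=> [S /finite_seqP[s ->] ->]; exists (size s), (tnth (in_tuple s)).
congr convex_hull; apply/seteqP; split=> [x /= xs|_ [i _ <-]].
  by have /tnthP[i ->] : x \in in_tuple s by []; exists i.
exact: mem_tnth.
Qed.

Lemma polytope_compact P : polytope P -> compact P.
Proof. by move=> /polytopeE[m [p ->]]; exact: convex_hull_compact. Qed.

End Convexity.

(** * Separation by a facet *)

(** Stands in for a derivative at [0]: the two variational arguments below need
    the sign of a linear term only. *)
Lemma ge0_linear_part (R : realFieldType) (a b e : R) : 0 < e ->
  (forall t, 0 < t -> t <= e -> 0 <= a + t * b) -> 0 <= a.
Proof.
move=> e_gt0 ab; rewrite leNgt; apply/negP => a_lt0.
have b1_gt0 : 0 < 2 * (`|b| + 1) by have := normr_ge0 b; lra.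
pose t := Num.min e (- a / (2 * (`|b| + 1))).
have t_gt0 : 0 < t by rewrite lt_min e_gt0 divr_gt0// oppr_gt0.
have te : t <= e by rewrite ge_min lexx.
have tb : t * (2 * (`|b| + 1)) <= - a.
  by rewrite -ler_pdivlMr// ge_min lexx orbT.
have := ab t t_gt0 te; have := ler_norm b; nra.
Qed.

Section Separation.
Context {R : realType} {d : nat}.
Implicit Types (P S A : set 'rV[R]_d) (q u v w x y : 'rV[R]_d).

(** The normal is [x - y] for the point [y] of [A] nearest to [x]: moving from
    [y] towards [z] in [A] cannot bring one closer to [x]. *)
Lemma compact_convex_separation A x : @convex_set R 'rV[R]_d A -> compact A ->
  A !=set0 -> ~ A x -> exists u, exists2 b, forall y, A y -> dotp y u <= b &
    b < dotp x u.
Proof.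
move=> cA kA A0 Ax.
have [|y /set_mem Ay ymin] :=
    @EVT_min_rV R d (fun y => dotp (x - y) (x - y)) A A0 kA.
  apply: continuous_subspaceT; apply: continuous_big.
    exact: add_continuous.
  move=> j _ y.
  have cj : continuous (fun y : 'rV[R]_d => (x - y) 0 j).
    rewrite (_ : (fun _ => _) = fun y => x 0 j - y 0 j); last first.
      by apply/funext => z; rewrite !mxE.
    move=> z.
    exact: (cvgB (cvg_cst (x 0 j)) (@coord_continuous R 1 d 0 j z)).
  exact: (cvgM (cj y) (cj y)).
exists (x - y), (dotp y (x - y)) => [z Az|]; last first.
  rewrite -subr_gt0 -dotpBl dotp_gt0 subr_eq0; apply/eqP => xy.
  by apply: Ax; rewrite xy.
rewrite -subr_ge0 -dotpBl.
suff : 0 <= 2 * dotp (y - z) (x - y) by rewrite pmulr_rge0.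
apply: (@ge0_linear_part _ _ (dotp (y - z) (y - z)) 1) => // t t0 t1.
have Azy := convex_setD cA Az Ay (ltW t0) t1.
have := ymin _ (mem_set Azy).
have -> : x - (t *: z + (1 - t) *: y) = (x - y) + t *: (y - z).
  by rewrite scalerBl scale1r scalerBr; apply/rowP => j; rewrite !mxE; ring.
move: (x - y) (y - z) => u v.
rewrite dotpDl !dotpDr !dotpZl !dotpZr [dotp u v]dotpC.
by rewrite -subr_ge0 => H; nra.
Qed.

End Separation.

Section Facets.
Context {R : realType}.

(** Full rank of [tight_mx] means that the points of [p] on the hyperplane span
    the space linearly from [q]; a basis chosen among them is an affine basis
    of the hyperplane. *)
Lemma facet_of_basis d (P : set 'rV[R]_d) q w m (p : 'I_m -> 'rV[R]_d) :
  P° q -> w != 0 -> (forall y, P y -> dotp (y - q) w <= 1) ->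
  (forall i, P (p i)) -> row_full (tight_mx (fun i => p i - q) w) ->
  facet P (P `&` [set y | dotp (y - q) w = 1]).
Proof.
case: d P q w p => [|k] P q w p qP w_neq0 Pw pP full.
  by rewrite thinmx0 eqxx in w_neq0.
split.
  exists w, (1 + dotp q w); split=> [y Py|].
    by rewrite -lerBlDr -dotpBl Pw.
  congr (_ `&` _); apply/seteqP; split=> y /=; rewrite dotpBl => /eqP.
    by rewrite subr_eq => /eqP.
  by rewrite -subr_eq => /eqP.
exists k; first exact: has_dim_interior qP.
pose f := fullrankfun full.
have f_unit := fullrowsub_unit full.
rewrite -row_free_unit -/f in f_unit.
have f_tight i : dotp (p (f i) - q) w = 1.
  apply/eqP; apply: contraT => /negPf it.
  have : (delta_mx 0 i : 'rV[R]_k.+1) *m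
        rowsub f (tight_mx (fun i => p i - q) w) =
      (0 : 'rV[R]_k.+1) *m rowsub f (tight_mx (fun i => p i - q) w).
    by rewrite -rowE row_rowsub row_tight it mul0mx.
  move=> /(row_free_inj f_unit)/rowP/(_ i)/eqP.
  by rewrite !mxE !eqxx oner_eq0.
have {}f_unit : row_free (\matrix_i (p (f i) - q)).
  rewrite (_ : \matrix_i _ = rowsub f (tight_mx (fun i => p i - q) w)) //.
  by apply/row_matrixP => i; rewrite rowK row_rowsub row_tight f_tight eqxx.
split.
  exists (fun i => p (f i)).
    by move=> i; split; [exact: pP|exact: f_tight].
  rewrite /affinely_independent -kermx_eq0; apply/rowV0P => l /sub_kermxP.
  rewrite mulmx_sum_row => l0.
  (* The relation [l] between the differences with the first point, written as
     a relation between the independent vectors [p (f i) - q]. *)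
  pose l' : 'rV[R]_k.+1 :=
    \row_j (if unlift ord0 j is Some i then l 0 i else - \sum_i l 0 i).
  have : l' *m (\matrix_i (p (f i) - q)) = 0 *m (\matrix_i (p (f i) - q)).
    rewrite mul0mx mulmx_sum_row big_ord_recl -[RHS]l0 mxE unlift_none rowK.
    rewrite scaleNr scaler_suml -sumrN -big_split; apply: eq_bigr => i _ /=.
    by rewrite !rowK mxE liftK addrC -scalerBr opprB subrKA.
  move=> /(row_free_inj f_unit)/rowP l'0; apply/rowP => i.
  by have := l'0 (lift ord0 i); rewrite !mxE liftK.
move=> p' p'F; rewrite /affinely_independent row_free_unit -row_full_unit.
move=> /row_full_orth w0; move/eqP: w_neq0; apply; apply: w0 => i.
have [_ /= i1] := p'F (lift ord0 i); have [_ /= i0] := p'F ord0.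
by move: i1 i0; rewrite rowK !dotpBl; lra.
Qed.

(** A point outside [P] violates an inequality valid on [P]; the pivot replaces
    this inequality by one that supports a facet and is violated at least as
    much. *)
Lemma facet_separation d (P : set 'rV[R]_d) q x :
  polytope P -> P° q -> ~ P x ->
  exists w, [/\ facet P (P `&` [set y | dotp (y - q) w = 1]),
    forall y, P y -> dotp (y - q) w <= 1 & 1 < dotp (x - q) w].
Proof.
move=> polyP qP Px; have Pq := interior_subset qP.
have [m [p PE]] := polytopeE polyP.
have [|u [b Pub bxu]] :=
    compact_convex_separation _ (polytope_compact polyP) (ex_intro _ q Pq) Px.
  by rewrite PE; exact: convex_hull_convex.
have u_neq0 : u != 0.
  by apply/eqP => u0; have := Pub _ Pq; move: bxu; rewrite u0 !dotp0r; lra.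
have bq_gt0 : 0 < b - dotp q u.
  by rewrite subr_gt0; exact: interior_supp_lt qP u_neq0 Pub.
pose w0 := (b - dotp q u)^-1 *: u.
have w0E y : dotp (y - q) w0 = (dotp y u - dotp q u) / (b - dotp q u).
  by rewrite dotpZr dotpBl mulrC.
have pP i : P (p i) by rewrite PE; apply: sub_gen_smallest; exists i.
(* No direction has all the [p i - q] on its nonpositive side, because [q] is
   interior. *)
have p_pos v : v != 0 -> exists i, 0 < dotp (p i - q) v.
  move=> v_neq0; apply: contrapT => /forallNP pv.
  have : dotp q v < dotp q v; last by rewrite ltxx.
  apply: (interior_supp_lt qP v_neq0); rewrite PE.
  apply: convex_hull_le => _ [i _ <-].
  by rewrite -subr_le0 -dotpBl leNgt; apply/negP.
have [|w [w_feas xw w_full]] := pivot p_pos (x - q) (u := w0).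
  by move=> i; rewrite w0E ler_pdivrMr// mul1r lerD2r Pub.
have xw1 : 1 < dotp (x - q) w.
  by apply: lt_le_trans xw; rewrite w0E ltr_pdivlMr// mul1r ltrD2r.
have Pw y : P y -> dotp (y - q) w <= 1.
  rewrite dotpBl lerBlDr PE; apply: convex_hull_le => _ [i _ <-].
  by rewrite -lerBlDr -dotpBl.
exists w; split=> //; apply: facet_of_basis w_full => //.
by apply/eqP => w_eq0; move: xw1; rewrite w_eq0 dotp0r ltr10.
Qed.

(** On the polar, each of the [k] terms of [\sum_i dotp y (p i - c)] is at most
    [1], so the sum reaches [k] only where all of them equal [1], which
    determines [y]. *)
Lemma facet_vertex d (P F : set 'rV[R]_d) c : P° c -> facet P F ->
  exists w, [/\ forall x, P x -> dotp (x - c) w <= 1,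
    F = P `&` [set x | dotp (x - c) w = 1],
    forall w', (forall x, F x -> dotp (x - c) w' = 1) -> w' = w &
    vertex (polar (translate P c)) w].
Proof.
move=> cP PF; have [w [k [p [Pw FE Fp p_full]]]] := facet_basis cP PF.
have pw i : dotp (p i - c) w = 1 by have := Fp i; rewrite FE => -[].
have p_inj w' : (forall i, dotp (p i - c) w' = 1) -> w' = w.
  move=> pw'; apply/eqP; rewrite -subr_eq0; apply/eqP.
  by apply: (row_full_orth p_full) => i; rewrite rowK dotpBr pw pw' subrr.
exists w; split=> // [w' Fw'|]; first by apply: p_inj => i; exact: Fw'.
have pPc i : translate P c (p i - c).
  by exists (p i) => //; have := Fp i; rewrite FE => -[].
exists (\sum_i (p i - c)), k%:R.
have kE : k%:R = \sum_(i < k) (1 : R) by rewrite sumr_const card_ord.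
split=> [y yP|].
  by rewrite dotp_sumr kE; apply: ler_sum => i _; exact: yP.
apply/seteqP; split=> [_ ->|y [yP /= yk]].
  split=> [_ [x Px <-]|/=]; first by rewrite dotpC Pw.
  by rewrite dotp_sumr kE; apply: eq_bigr => i _; rewrite dotpC pw.
apply: p_inj => i; apply/eqP; rewrite eq_sym -subr_eq0 dotpC.
have := @psumr_eq0P _ _ xpredT (fun i => 1 - dotp y (p i - c)).
move=> -> //; first by move=> j _; rewrite subr_ge0; exact: yP.
by rewrite sumrB -dotp_sumr yk -kE subrr.
Qed.

End Facets.

(** * Maximising the weighted product of slacks *)

(** A negative number has power [1] for [`^], so the absolute value is what
    makes the function continuous at [0]; slacks being nonnegative on the
    polytope, it does not change the maximisation. *)
Lemma norm_powR_continuous (R : realType) (a : R) : 0 < a ->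
  continuous (fun z : R => `|z| `^ a).
Proof.
move=> a_gt0 z; have [->|z_neq0] := eqVneq z 0; last first.
  have z_gt0 : 0 < `|z| by rewrite normr_gt0.
  apply: (@continuous_comp _ _ _ (fun z : R => `|z|) (fun y => y `^ a)).
    exact: norm_continuous.
  apply: differentiable_continuous; apply/derivable1_diffP.
  by apply: derivable_powR; rewrite in_itv/= z_gt0.
rewrite /continuous_at normr0 powR0 ?gt_eqF//.
apply/cvgrPdist_lt => e e_gt0; near=> y.
rewrite sub0r normrN ger0_norm ?powR_ge0//.
have -> : e = (e `^ a^-1) `^ a.
  by rewrite -powRrM mulVf ?powRr1 ?ltW// gt_eqF.
apply: gt0_ltr_powR; rewrite ?nnegrE ?powR_ge0//.
near: y; apply/nbhs_ballP; exists (e `^ a^-1); first exact: powR_gt0.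
by move=> y; rewrite /ball/= sub0r normrN.
Unshelve. all: by end_near.
Qed.

Lemma ln1B_ge (R : realType) (y : R) : `|y| <= 2^-1 ->
  - (y + 2 * y ^+ 2) <= ln (1 - y).
Proof.
rewrite ler_norml => /andP[y_ge y_le].
have y1_gt0 : 0 < 1 - y by lra.
have e1 : (1 - y)^-1 = 1 + y / (1 - y) by field; rewrite gt_eqF.
have : ln (1 - y)^-1 <= y / (1 - y).
  by rewrite [X in ln X]e1 le_ln1Dx// -subr_gt0 opprK addrC -e1 invr_gt0.
rewrite lnV ?posrE// => lnle; rewrite lerNl; apply: (le_trans lnle).
rewrite ler_pdivrMr//; nra.
Qed.

(** The product is [1] at [t = 0], and its logarithm is bounded below for small
    [t] by a quadratic polynomial in [t] whose linear coefficient is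
    [- \sum_i alpha i * a i]. *)
Lemma weighted_prod_first_order (R : realType) n (alpha a : 'I_n -> R) (e : R) :
  (forall i, 0 < alpha i) -> 0 < e ->
  (forall t, 0 < t -> t <= e -> \prod_i `|1 - t * a i| `^ alpha i <= 1) ->
  0 <= \sum_i alpha i * a i.
Proof.
move=> alpha_gt0 e_gt0 prod_le.
pose s := \sum_i `|a i|; have s_ge0 : 0 <= s by exact: sumr_ge0.
pose e' := Num.min e (2 * (s + 1))^-1.
have e'_gt0 : 0 < e' by rewrite lt_min e_gt0 invr_gt0; lra.
apply: (@ge0_linear_part _ _ (\sum_i alpha i * (2 * a i ^+ 2)) _ e'_gt0).
move=> t t_gt0 te'.
have te : t <= e by apply: le_trans te' _; rewrite ge_min lexx.
have ta i : `|t * a i| <= 2^-1.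
  have ais : `|a i| <= s by rewrite /s (bigD1 i)//= lerDl sumr_ge0.
  have : t * (2 * (s + 1)) <= 1.
    rewrite -ler_pdivlMr ?div1r; last by lra.
    by apply: le_trans te' _; rewrite ge_min lexx orbT.
  by rewrite normrM gtr0_norm//; have := normr_ge0 (a i); nra.
have ta_gt0 i : 0 < 1 - t * a i.
  by have := ta i; rewrite ler_norml => /andP[_]; lra.
have : \sum_i alpha i * ln (1 - t * a i) <= 0.
  rewrite -expR_le1 expR_sum; apply: le_trans (prod_le t t_gt0 te).
  rewrite le_eqVlt; apply/predU1P; left; apply: eq_bigr => i _.
  by rewrite gtr0_norm// /powR gt_eqF.
move=> sum_le; rewrite -(pmulr_rge0 _ t_gt0) mulrDr !mulr_sumr -big_split.
apply: (@le_trans _ _ (\sum_i - (alpha i * ln (1 - t * a i)))).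
  by rewrite sumrN oppr_ge0.
apply: ler_sum => i _ /=; rewrite lerNl.
have := ln1B_ge (ta i); rewrite -(ler_pM2l (alpha_gt0 i)); apply: le_trans.
by rewrite le_eqVlt; apply/predU1P; left; ring.
Qed.

Section Slack.
Context {R : realType} {d : nat}.

Lemma slack_continuous (q w : 'rV[R]_d) :
  continuous (fun x : 'rV[R]_d => 1 - dotp (x - q) w).
Proof.
rewrite (_ : (fun _ => _) =
  fun x : 'rV[R]_d => (1 + dotp q w) - dotp x w); last first.
  by apply/funext => x; rewrite dotpBl; ring.
by move=> x; exact: (cvgB (cvg_cst (1 + dotp q w)) (@dotp_continuousl R d w x)).
Qed.

Lemma slack_prod_continuous n (alpha : 'I_n -> R) q (w : 'I_n -> 'rV[R]_d) :
  (forall i, 0 < alpha i) ->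
  continuous (fun x : 'rV[R]_d => \prod_i `|1 - dotp (x - q) (w i)| `^ alpha i).
Proof.
move=> alpha_gt0; apply: continuous_big => [|i _ x].
  exact: mul_continuous.
apply: (@continuous_comp _ _ _ (fun x : 'rV[R]_d => 1 - dotp (x - q) (w i))
  (fun z => `|z| `^ alpha i)); first exact: slack_continuous.
exact: norm_powR_continuous.
Qed.

End Slack.

Unset Implicit Arguments.
Set Strict Implicit.

Theorem theorem3p1 (R : realType) (d : nat) (d_gt0 : (0 < d)%N)
    (P : set 'rV[R]_d) (n : nat) (F : 'I_n -> set 'rV[R]_d)
    (P_polytope : polytope P) (P_int : P° !=set0)
    (F_inj : injective F) (F_facets : range F = facet P)
    (alpha : 'I_n -> R) (alpha_gt0 : forall i, 0 < alpha i) :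
  exists2 c : 'rV[R]_d, P° c &
    exists2 w : 'I_n -> 'rV[R]_d,
      forall i, unique (corresponding_vertex P c (F i)) (w i) &
      \sum_(i < n) alpha i *: w i = 0.
Proof.
have [q qP] := P_int.
have facetF i : facet P (F i) by rewrite -F_facets; exists i.
have [w0 w0P] := choice (fun i => facet_vertex qP (facetF i)).
pose slack i (x : 'rV[R]_d) : R := 1 - dotp (x - q) (w0 i).
have slack_ge0 i x : P x -> 0 <= slack i x.
  by move=> Px; have [Pw _ _ _] := w0P i; rewrite subr_ge0 Pw.
pose Phi x := \prod_i `|slack i x| `^ alpha i.
have Phi_cont : continuous Phi by exact: slack_prod_continuous.
have [c /set_mem Pc cmax] := EVT_max_rV (ex_intro _ q (interior_subset qP))
  (polytope_compact P_polytope) (continuous_subspaceT Phi_cont).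
have Phi_c_gt0 : 0 < Phi c.
  have := cmax q (mem_set (interior_subset qP)); apply: lt_le_trans.
  apply: prodr_gt0 => i _; apply: powR_gt0.
  by rewrite /slack subrr dotp0l subr0 normr1.
have slack_c i : 0 < slack i c.
  rewrite lt_def slack_ge0// andbT; apply/eqP => sc0; move: Phi_c_gt0.
  by rewrite /Phi (bigD1 i)//= sc0 normr0 powR0 ?gt_eqF// mul0r ltxx.
(* Were a point with positive slacks outside [P], it would violate a facet
   inequality, and that inequality is one of the slacks by uniqueness of
   normals. *)
have cP : P° c.
  have : \forall x \near c, forall i, 0 < slack i x.
    apply: (@filter_forall _ _ (fun i x => 0 < slack i x) (nbhs c) _) => i.
    have sc : slack i x @[x --> c] --> slack i c by exact: slack_continuous.
    exact: (cvgr_gt _ sc _ (slack_c i)).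
  apply: filterS => x xslack; apply: contrapT => Px.
  have [w [PF _ xw]] := facet_separation P_polytope qP Px.
  have : range F (P `&` [set y | dotp (y - q) w = 1]) by rewrite F_facets.
  move=> [i _ FE]; have [_ _ w_uniq _] := w0P i.
  have wE : w = w0 i by apply: w_uniq => y; rewrite FE => -[].
  by have := xslack i; rewrite /slack -wE subr_gt0 ltNge (ltW xw).
pose w i := (slack i c)^-1 *: w0 i.
have wE i x : dotp (x - c) (w i) = 1 - slack i x / slack i c.
  have := slack_c i; rewrite /w dotpZr /slack !dotpBl => sc_gt0.
  by field; rewrite gt_eqF.
exists c => //; exists w => [i|].
  have [w1 [Pw1 FE w1_uniq w1_vertex]] := facet_vertex cP (facetF i).
  have -> : w i = w1.
    apply: w1_uniq => x; have [_ -> _ _] := w0P i => -[_ /= xw0].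
    by rewrite wE /slack xw0 subrr mul0r subr0.
  split.
    split=> //; apply/seteqP; split=> [_ [x Fx <-]|_ [[x Px <-] xw1]].
      by move: Fx; rewrite FE => -[Px xw1]; split=> //; exists x.
    by exists x => //; rewrite FE.
  move=> w' [_ Fw']; apply/esym; apply: w1_uniq => x Fx.
  have : translate (F i) c (x - c) by exists x.
  by rewrite Fw' => -[].
pose g := \sum_i alpha i *: w i.
apply/eqP; rewrite -dotp_eq0 -/g eq_le dotp_ge0 andbT.
(* Moving from [c] in the direction [- g] increases [Phi] to first order unless
   [g = 0]. *)
have [e e_gt0 Pe] := interior_dir (- g) cP.
suff : 0 <= \sum_i alpha i * dotp (- g) (w i).
  move=> H; rewrite -oppr_ge0 {2}/g dotp_sumr -sumrN; apply: (le_trans H).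
  apply: ler_sum => i _.
  by rewrite (dotpZr (alpha i)) dotpNl mulrN.
apply: (@weighted_prod_first_order _ _ _ _ e) => // t t_gt0 te.
have Pt : P (c + t *: - g) by apply: Pe => //; exact: ltW.
have := cmax _ (mem_set Pt).
have -> : Phi (c + t *: - g) =
    Phi c * \prod_i `|1 - t * dotp (- g) (w i)| `^ alpha i.
  rewrite /Phi -big_split; apply: eq_bigr => i _ /=.
  rewrite -powRM// -normrM; congr (`|_| `^ _).
  have := wE i (c + t *: - g); rewrite addrAC subrr add0r dotpZl => ->.
  by have := slack_c i => sc; field; rewrite gt_eqF.
by rewrite ger_pMr.
Qed.
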